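(* Let $T$ be a string of length $n$ over an alphabet $\Sigma$ of size $\sigma\ge 2$. For any $1<i\le j\le n$, $|\mathsf{MUS}(T[i-1..j])\bigtriangleup\mathsf{MUS}(T[i..j])|\le 4$ and $-1\le|\mathsf{MUS}(T[i-1..j])|-|\mathsf{MUS}(T[i..j])|\le 2$. Furthermore, these bounds are tight: for any $\sigma\ge 3$ and any $i,j$ with $1<i\le j\le n$ and $j-i+1\ge 5$, there exist strings $T$ over an alphabet of size $\sigma$ attaining $|\mathsf{MUS}(T[i-1..j])\bigtriangleup\mathsf{MUS}(T[i..j])|=4$, strings attaining $|\mathsf{MUS}(T[i-1..j])|-|\mathsf{MUS}(T[i..j])|=2$, and strings attaining $|\mathsf{MUS}(T[i-1..j])|-|\mathsf{MUS}(T[i..j])|=-1$.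
   Context: $T[a..b]$ denotes the substring of $T$ from position $a$ to $b$. For a string $S$ and a string $w$, $\#\mathit{occ}_S(w)$ is the number of positions at which $w$ occurs in $S$; by convention $\#\mathit{occ}_S(\varepsilon)=|S|+1$. A substring $w$ of $S$ is unique in $S$ if $\#\mathit{occ}_S(w)=1$ and repeating in $S$ if $\#\mathit{occ}_S(w)\ge 2$. For $1\le i\le j\le n$, $\mathsf{MUS}(T[i..j])$ is the set of intervals $[s,t]$ (positions in $T$) with $i\le s\le t\le j$ such that $T[s..t]$ is unique in $T[i..j]$ and every proper substring of $T[s..t]$ (including the empty string) is repeating in $T[i..j]$. $\bigtriangleup$ denotes symmetric difference. *)

(* Defs.v *)
From mathcomp Require Import all_boot all_order all_algebra.
Set Implicit Arguments. Unset Strict Implicit. Unset Printing Implicit Defensive.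

Section Strings.
Variable A : eqType.

(* T[a..b] with 1-indexed positions (for 1 <= a <= b+1) *)
Definition substr (T : seq A) (a b : nat) : seq A := take (b.+1 - a) (drop a.-1 T).

(* #occ_S(w); by convention #occ_S(eps) = |S| + 1 *)
Definition occ (S w : seq A) : nat :=
  if w is [::] then (size S).+1
  else count (fun p => take (size w) (drop p S) == w) (iota 0 (size S)).

Definition uniqueb (S w : seq A) : bool := occ S w == 1.
Definition repeatingb (S w : seq A) : bool := 2 <= occ S w.

(* every proper substring u of w (including the empty string) is repeating in S;
   the substrings of w are exactly w[a..b) = take (b-a) (drop a w), 0 <= a <= b <= |w|,
   proper iff b - a < |w| *)
Definition proper_subs_repeating (S w : seq A) : bool :=
  [forall a : 'I_(size w).+1, forall b : 'I_(size w).+1,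
     ((a <= b) && (b - a < size w)) ==> repeatingb S (take (b - a) (drop a w))].

Definition is_mus (T : seq A) (i j s t : nat) : bool :=
  [&& i <= s, s <= t, t <= j,
      uniqueb (substr T i j) (substr T s t) &
      proper_subs_repeating (substr T i j) (substr T s t)].

End Strings.

(* MUS(T[i..j]) as a finite set of intervals [s,t] of positions of T *)
Definition MUS (A : eqType) (T : seq A) (i j : nat) : {set 'I_(size T).+1 * 'I_(size T).+1} :=
  [set p : 'I_(size T).+1 * 'I_(size T).+1 | is_mus T i j p.1 p.2].

Definition symdiff (X : finType) (B C : {set X}) : {set X} := (B :\: C) :|: (C :\: B).

(* Main.v *)
(** Extending the window [i+1..j] to [i..j] only raises the number of occurrences
    of prefixes of the longer window, by one each.  A deleted MUS must therefore
    be a prefix of the longer window occurring exactly once in the shorter one,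
    and by minimality there is only one such MUS.  An added MUS either starts at
    position i, or becomes minimal because its longest proper prefix or its
    longest proper suffix is a prefix of the longer window occurring once in the
    shorter one; each of these three kinds contributes at most one interval.  The
    last two kinds moreover force a deletion, whence the bound 3 - 1 = 2.  The
    bounds are attained by the windows c a^m c b b and a b a^m c a b. *)
Require Import Defs.
From mathcomp Require Import all_boot all_order all_algebra.
From mathcomp Require Import zify.
Import GRing.Theory Num.Theory.
Set Implicit Arguments. Unset Strict Implicit. Unset Printing Implicit Defensive.

(** * Repeating and minimal unique factors in terms of positions *)

Section Factors.
Variables (A : eqType) (f : nat -> A).

Definition same_factor (p s l : nat) : bool :=
  all (fun d => f (p + d) == f (s + d)) (iota 0 l).

(** The occurrence at [s] itself is left out, so for a factor inside the window the negation of
    [repeats] is uniqueness. *)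
Definition repeats (i j s l : nat) : bool :=
  has (fun p => [&& p != s, p + l <= j.+1 & same_factor p s l])
      (iota i (j.+1 - i)).

(** Repetition passes to shorter nonempty factors, so testing the longest proper prefix and suffix
    suffices. When [s = t] only the empty string remains, and it always repeats. *)
Definition mus (i j s t : nat) : bool :=
  [&& i <= s, s <= t, t <= j, ~~ repeats i j s (t - s).+1 &
      (s < t) ==> repeats i j s (t - s) && repeats i j s.+1 (t - s)].

Lemma same_factorP p s l :
  reflect (forall d, d < l -> f (p + d) = f (s + d)) (same_factor p s l).
Proof.
apply: (iffP allP) => [H d dl|H d]; first by apply/eqP/H; rewrite mem_iota.
by rewrite mem_iota => /= dl; apply/eqP/H.
Qed.

Lemma repeatsP i j s l :
  reflect (exists p, [/\ i <= p <= j, p != s, p + l <= j.+1 &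
                         forall d, d < l -> f (p + d) = f (s + d)])
          (repeats i j s l).
Proof.
apply: (iffP hasP) => [[p]|[p [H1 H2 H3 H4]]].
  rewrite mem_iota => ip /and3P[H1 H2 /same_factorP H3].
  by exists p; split=> //; lia.
exists p; first by rewrite mem_iota; lia.
by apply/and3P; split=> //; apply/same_factorP.
Qed.

Lemma repeats_sub i j s l s' l' :
  s <= s' -> s' + l' <= s + l -> 0 < l' -> repeats i j s l -> repeats i j s' l'.
Proof.
move=> ss' sl l'0 /repeatsP[p [H1 H2 H3 H4]]; apply/repeatsP.
exists (p + (s' - s)); split; [lia | lia | lia | move=> d dl].
have := H4 (s' - s + d); rewrite !addnA.
have -> : s + (s' - s) = s' by lia.
by move=> -> //; lia.
Qed.

Lemma repeats_window i j s l : repeats i.+1 j s l -> repeats i j s l.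
Proof.
by move=> /repeatsP[p [H1 H2 H3 H4]]; apply/repeatsP; exists p; split=> //; lia.
Qed.

(** [i] is the only starting position that the shorter window lacks. *)
Lemma repeats_at_start i j s l : repeats i j s l -> ~~ repeats i.+1 j s l ->
  i + l <= j.+1 /\ forall d, d < l -> f (i + d) = f (s + d).
Proof.
move=> /repeatsP[p [H1 H2 H3 H4]] /repeatsP nr.
have [ip|pi] := ltnP i p; first by case: nr; exists p; split=> //; lia.
by have -> : i = p by lia.
Qed.

(** Otherwise the shorter one would lie within the longest proper prefix of the longer one, which
    repeats. *)
Lemma mus_same_start i j s t1 t2 : mus i j s t1 -> mus i j s t2 -> t1 = t2.
Proof.
wlog le12 : t1 t2 / t1 <= t2 => [H m1 m2|].
  by have [le|/ltnW le] := leqP t1 t2; [exact: H | symmetry; exact: H].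
move=> /and5P[_ st1 _ u1 _] /and5P[_ st2 _ _ /implyP r2].
case: (ltngtP t1 t2) le12 => // lt12 _; case/negP: u1.
have /andP[r _] : repeats i j s (t2 - s) && repeats i j s.+1 (t2 - s)
  by apply: r2; lia.
by apply: repeats_sub r; lia.
Qed.

(** Both factors are prefixes of the text at [i], so the shorter one also occurs at [s2]; its
    uniqueness past [i] then identifies the two positions. *)
Lemma start_occurrence_unique i j s1 l1 s2 l2 :
    i < s1 -> i < s2 -> 0 < l1 -> l1 <= l2 ->
    s1 + l1 <= j.+1 -> s2 + l2 <= j.+1 ->
    (forall d, d < l1 -> f (i + d) = f (s1 + d)) ->
    (forall d, d < l2 -> f (i + d) = f (s2 + d)) ->
    ~~ repeats i.+1 j s1 l1 -> s1 = s2.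
Proof.
move=> is1 is2 l10 l12 b1 b2 e1 e2 /repeatsP nr; apply/eqP/negPn/negP => ne.
case: nr; exists s2; split; [lia | by rewrite eq_sym | lia |].
by move=> d dl; rewrite -e1 // -e2 //; lia.
Qed.

(** Proper factors keep repeating when the window grows, so only uniqueness can be lost, and only
    through an occurrence at [i]. *)
Lemma mus_deletedP i j s t : mus i.+1 j s t -> ~~ mus i j s t ->
  i + (t - s).+1 <= j.+1 /\ forall d, d < (t - s).+1 -> f (i + d) = f (s + d).
Proof.
move=> /and5P[ilt st tj u r] nm; apply: repeats_at_start => //.
apply: contraNT nm => u'; apply/and5P; split=> //; first exact: ltnW.
by apply: contraTT r; rewrite !negb_imply => /andP[->] /=;
  apply: contra => /andP[/repeats_window -> /repeats_window ->].
Qed.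

Lemma mus_deleted_unique i j s1 t1 s2 t2 :
  mus i.+1 j s1 t1 -> ~~ mus i j s1 t1 ->
  mus i.+1 j s2 t2 -> ~~ mus i j s2 t2 -> (s1, t1) = (s2, t2).
Proof.
wlog le12 : s1 t1 s2 t2 / t1 - s1 <= t2 - s2 => [H m1 n1 m2 n2|].
  by have [le|/ltnW le] := leqP (t1 - s1) (t2 - s2); [exact: H | symmetry; exact: H].
move=> m1 n1 m2 n2; have [b1 e1] := mus_deletedP m1 n1.
have [b2 e2] := mus_deletedP m2 n2.
case/and5P: (m1) => is1 st1 tj1 u1 _; case/and5P: (m2) => is2 st2 tj2 _ _.
have E : s1 = s2.
  by apply: (start_occurrence_unique is1 is2 _ _ _ _ e1 e2 u1); lia.
by subst s2; rewrite (mus_same_start m1 m2).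
Qed.

(** The longest proper prefix repeats thanks to the occurrence at [i] alone, and the MUS extends it
    by one letter on the right. [left_added] is the mirror case, for the longest proper suffix. *)
Definition right_added i j s t :=
  [&& mus i j s t, i < s, s < t, same_factor i s (t - s) &
      ~~ repeats i.+1 j s (t - s)].
Definition left_added i j s t :=
  [&& mus i j s t, i < s, s < t, same_factor i s.+1 (t - s) &
      ~~ repeats i.+1 j s.+1 (t - s)].

(** Uniqueness is inherited by the shorter window, so for [s != i] one of the two longest proper
    factors must owe its repetition to the occurrence at [i]. *)
Lemma mus_addedP i j s t : mus i j s t -> ~~ mus i.+1 j s t ->
  [|| s == i, right_added i j s t | left_added i j s t].
Proof.
move=> m nm; rewrite /right_added /left_added m; case: (m) => /and5P[is_ st tj u r].
case: eqVneq => //= si; have -> /= : i < s by lia.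
move: nm; rewrite /mus st tj; have -> /= : i < s by lia.
rewrite (contra (@repeats_window i j s _) u) /= negb_imply => /andP[st' nr].
move: r; rewrite st' /= => /andP[r1 r2]; move: nr; rewrite negb_and.
case/orP => nr; [have [_ e] := repeats_at_start r1 nr
               |have [_ e] := repeats_at_start r2 nr];
  by rewrite nr andbT; move/same_factorP: e => ->; rewrite ?orbT.
Qed.

Lemma right_added_unique i j s1 t1 s2 t2 :
  right_added i j s1 t1 -> right_added i j s2 t2 -> (s1, t1) = (s2, t2).
Proof.
wlog le12 : s1 t1 s2 t2 / t1 - s1 <= t2 - s2 => [H m1 m2|].
  by have [le|/ltnW le] := leqP (t1 - s1) (t2 - s2); [exact: H | symmetry; exact: H].
move=> /and5P[m1 is1 st1 /same_factorP e1 u1] /and5P[m2 is2 st2 /same_factorP e2 _].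
case/and5P: (m1) => _ _ tj1 _ _; case/and5P: (m2) => _ _ tj2 _ _.
have E : s1 = s2.
  by apply: (start_occurrence_unique is1 is2 _ _ _ _ e1 e2 u1); lia.
by subst s2; rewrite (mus_same_start m1 m2).
Qed.

Lemma left_added_unique i j s1 t1 s2 t2 :
  left_added i j s1 t1 -> left_added i j s2 t2 -> (s1, t1) = (s2, t2).
Proof.
wlog le12 : s1 t1 s2 t2 / t1 - s1 <= t2 - s2 => [H m1 m2|].
  by have [le|/ltnW le] := leqP (t1 - s1) (t2 - s2); [exact: H | symmetry; exact: H].
move=> /and5P[m1 is1 st1 /same_factorP e1 u1] /and5P[m2 is2 st2 /same_factorP e2 _].
case/and5P: (m1) => _ _ tj1 _ _; case/and5P: (m2) => _ _ tj2 _ _.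
have [E] : s1.+1 = s2.+1.
  by apply: (start_occurrence_unique _ _ _ _ _ _ e1 e2 u1); lia.
by subst s2; rewrite (mus_same_start m1 m2).
Qed.

(* The shortest prefix of the longer window that occurs exactly once in the
   shorter one is a MUS there: dropping its first letter leaves a factor that
   also occurs at [i.+1]. *)
Lemma mus_deleted_exists i j s l : i < s -> 0 < l -> s + l <= j.+1 ->
  same_factor i s l -> ~~ repeats i.+1 j s l ->
  exists q r, mus i.+1 j q r && ~~ mus i j q r.
Proof.
move=> is0 l0 sl e u.
pose Q k := (0 < k) && has (fun q => [&& i < q, q + k <= j.+1, same_factor i q k &
                                  ~~ repeats i.+1 j q k]) (iota 0 j.+1).
have exQ : exists k, Q k.
  exists l; rewrite /Q l0; apply/hasP; exists s; first by rewrite mem_iota; lia.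
  by rewrite is0 sl e u.
case: (ex_minnP exQ) => k /andP[k0 /hasP[q _ /and4P[iq qk /same_factorP eq uq]]] kmin.
exists q, (q + k.-1).
have kE : q + k.-1 - q = k.-1 by lia.
rewrite /mus !kE prednK //; apply/andP; split; last first.
  rewrite !negb_and !negbK; apply/orP; right; apply/orP; right; apply/orP; right.
  by apply/orP; left; apply/repeatsP; exists i; split=> //; lia.
apply/and5P; split=> //; [lia | lia | apply/implyP => k1; apply/andP; split].
  apply/negPn/negP => nr; suff /kmin : Q k.-1 by lia.
  rewrite /Q; apply/andP; split; first by lia.
  apply/hasP; exists q; first by rewrite mem_iota; lia.
  rewrite iq nr andbT /=; apply/andP; split; first by lia.
  by apply/same_factorP => d dk; apply: eq; lia.
apply/repeatsP; exists i.+1; split; [lia | lia | lia | move=> d dk].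
by rewrite !addSnnS; apply: eq; lia.
Qed.

Lemma repeats1P i j s :
  reflect (exists p, [/\ i <= p <= j, p != s & f p = f s]) (repeats i j s 1).
Proof.
apply: (iffP (repeatsP _ _ _ _)) => [[p [H1 H2 H3 H4]]|[p [H1 H2 H3]]]; exists p.
  by split=> //; have := H4 0 isT; rewrite !addn0.
by split=> //; [lia | move=> [|d] //; rewrite !addn0].
Qed.

Lemma repeats2P i j s :
  reflect (exists p, [/\ i <= p < j, p != s, f p = f s & f p.+1 = f s.+1])
          (repeats i j s 2).
Proof.
apply: (iffP (repeatsP _ _ _ _)) => [[p [H1 H2 H3 H4]]|[p [H1 H2 H3 H4]]]; exists p.
  split=> //; first lia; first by have := H4 0 isT; rewrite !addn0.
  by have := H4 1 isT; rewrite !addn1.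
by split=> //; [lia | lia | move=> [|[|d]] //; rewrite ?addn0 ?addn1].
Qed.

Lemma mus2E i j s : mus i j s s.+1 =
  [&& i <= s, s < j, ~~ repeats i j s 2, repeats i j s 1 & repeats i j s.+1 1].
Proof. by rewrite /mus leqnSn ltnSn subSnn. Qed.

End Factors.

(** * From occurrence counts of substrings to positions *)

Lemma count_iota_but (P : pred nat) (N p0 : nat) : p0 < N -> P p0 ->
  count P (iota 0 N) = (count (fun p => (p != p0) && P p) (iota 0 N)).+1.
Proof.
move=> p0N Pp0; rewrite -size_filter -(count_predC (pred1 p0)) !count_filter.
rewrite -add1n; congr (_ + _).
rewrite (@eq_count _ _ (pred1 p0)) => [|p /=].
  by rewrite count_uniq_mem ?iota_uniq // mem_iota /= add0n p0N.
by case: eqVneq => // ->; rewrite Pp0.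
Qed.

Section Windows.
Variables (A : eqType) (x0 : A) (T : seq A).
Let f (p : nat) : A := nth x0 T p.-1.

Lemma size_substr a b : 0 < a -> b <= size T -> size (substr T a b) = b.+1 - a.
Proof. by move=> a0 bT; rewrite /substr size_take size_drop; case: ltnP; lia. Qed.

Lemma occurrence_same i j s t q :
  0 < i -> i <= s -> s <= t -> t <= j -> j <= size T ->
  (take (size (substr T s t)) (drop q (substr T i j)) == substr T s t) =
  (q + (t - s).+1 <= j.+1 - i) && same_factor f (i + q) s (t - s).+1.
Proof.
move=> i0 is_ st tj jT; rewrite size_substr; [|lia|lia].
have -> : t.+1 - s = (t - s).+1 by lia.
set l := (t - s).+1.
have szS : size (substr T i j) = j.+1 - i by rewrite size_substr.
have szw : size (substr T s t) = l by rewrite size_substr; lia.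
have nS d : d < j.+1 - i -> nth x0 (substr T i j) d = f (i + d).
  by move=> dl; rewrite /substr nth_take // nth_drop /f; congr nth; lia.
have nw d : d < l -> nth x0 (substr T s t) d = f (s + d).
  by move=> dl; rewrite /substr nth_take ?nth_drop /f; [congr nth; lia|lia].
apply/eqP/andP => [E|[ql /same_factorP e]].
  (* [take] truncates at the end of the window, so the bound on [q] has to come from comparing
     sizes. *)
  have := congr1 size E; rewrite szw size_take size_drop szS => El.
  have ql : q + l <= j.+1 - i by move: El; case: ltnP; lia.
  split=> //; apply/same_factorP => d dl; rewrite -nw // -E nth_take // nth_drop.
  by rewrite nS ?addnA //; lia.
apply: (@eq_from_nth _ x0) => [|d].
  by rewrite szw size_take size_drop szS; case: ltnP; lia.
rewrite size_take size_drop szS => dlt.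
have dl : d < l by move: dlt; case: (ltnP l _); lia.
by rewrite nth_take // nth_drop nw // nS ?addnA ?e //; lia.
Qed.

Lemma occ_substr i j s t :
  0 < i -> i <= s -> s <= t -> t <= j -> j <= size T ->
  uniqueb (substr T i j) (substr T s t) = ~~ repeats f i j s (t - s).+1 /\
  repeatingb (substr T i j) (substr T s t) = repeats f i j s (t - s).+1.
Proof.
move=> i0 is_ st tj jT.
have szS : size (substr T i j) = j.+1 - i by rewrite size_substr.
set P := fun q => (q + (t - s).+1 <= j.+1 - i) && same_factor f (i + q) s (t - s).+1.
have occE : occ (substr T i j) (substr T s t) = count P (iota 0 (j.+1 - i)).
  rewrite /occ szS; case E: (substr T s t) => [|x w].
    by have := congr1 size E; rewrite size_substr /=; lia.
  by rewrite -E; apply: eq_count => q; rewrite occurrence_same.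
have -> : repeats f i j s (t - s).+1 =
          (0 < count (fun q => (q != s - i) && P q) (iota 0 (j.+1 - i))).
  rewrite -has_count /repeats -[i in iota i]addn0 iotaDl has_map.
  apply: eq_in_has => q; rewrite mem_iota /= /P => qj.
  by congr [&& _, _ & _]; lia.
rewrite /uniqueb /repeatingb occE.
(* Offset [s - i] is the factor's own occurrence; removing it leaves those sought by [repeats]. *)
rewrite (@count_iota_but P _ (s - i)) /P; [|lia|].
  by split; [rewrite eqSS eqn0Ngt | rewrite ltnS].
apply/andP; split; first lia.
by apply/same_factorP => d _; congr f; lia.
Qed.

Lemma is_musE i j s t : 0 < i -> i <= j -> j <= size T ->
  is_mus T i j s t = mus f i j s t.
Proof.
move=> i0 ij jT; rewrite /is_mus /mus.
case: (leqP i s) => //= is_; case: (leqP s t) => //= st; case: (leqP t j) => //= tj.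
have [-> _] := occ_substr i0 is_ st tj jT; congr (_ && _).
have szw : size (substr T s t) = (t - s).+1 by rewrite size_substr; lia.
have subE a b : a < b -> b <= (t - s).+1 ->
    take (b - a) (drop a (substr T s t)) = substr T (s + a) (s + b.-1).
  move=> ab bt; rewrite /substr take_drop subnK; last exact: ltnW.
  rewrite take_takel; last lia.
  rewrite -{1}(subnK (ltnW ab)) -take_drop drop_drop.
  by congr (take _ (drop _ _)); lia.
have subR a b : a < b -> b <= (t - s).+1 ->
    repeatingb (substr T i j) (take (b - a) (drop a (substr T s t))) =
    repeats f i j (s + a) (b - a).
  move=> ab bt; rewrite subE //.
  have [||||_ ->] := @occ_substr i j (s + a) (s + b.-1) i0; try lia.
  by congr repeats; lia.
apply/forallP/implyP => [H st'|H a].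
  (* The bounds [0, t - s] and [1, (t - s).+1] cut out the longest proper prefix and suffix. *)
  move: (H ord0) => /forallP/(_ (inord (t - s))).
  move: (H (inord 1)) => /forallP/(_ (inord (t - s).+1)).
  rewrite !inordK; [|lia|lia|lia].
  rewrite /= !subR ?szw; [|lia|lia|lia|lia].
  rewrite addn0 addn1 subn0 subn1 /= => H1 H2; apply/andP; split.
    by apply: (implyP H2); lia.
  by apply: (implyP H1); lia.
apply/forallP => b; apply/implyP => /andP[ab bal].
have bt := ltn_ord b.
case: (ltnP a b) => ab'; last first.
  (* The window is nonempty, so the convention for the empty string gives at least two
     occurrences. *)
  have -> : b - a = 0 by lia.
  by rewrite take0 /repeatingb /occ size_substr //; lia.
have /H/andP[r1 r2] : s < t by lia.
rewrite subR //; last lia.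
(* A factor at offset 0 lies in the longest proper prefix, any other in the longest proper
   suffix. *)
case: (posnP a) => [a0|apos].
  by apply: repeats_sub r1; lia.
by apply: repeats_sub r2; lia.
Qed.
End Windows.

Lemma in_MUS (A : eqType) (x0 : A) (T : seq A) (i j : nat) p :
  0 < i -> i <= j -> j <= size T ->
  (p \in MUS T i j) = mus (fun q => nth x0 T q.-1) i j p.1 p.2.
Proof. by move=> i0 ij jT; rewrite inE (is_musE x0). Qed.

(** * Counting deleted and added intervals *)

Section Cardinals.
Variables (A : eqType) (x0 : A) (T : seq A) (i j : nat).
Hypotheses (i0 : 0 < i) (ij : i < j) (jT : j <= size T).
Let f (p : nat) : A := nth x0 T p.-1.
Let M := MUS T i j.
Let M' := MUS T i.+1 j.

Lemma card_le1_inj (P : nat -> nat -> bool) :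
  (forall s1 t1 s2 t2, P s1 t1 -> P s2 t2 -> (s1, t1) = (s2, t2)) ->
  #|[set p : 'I_(size T).+1 * 'I_(size T).+1 | P p.1 p.2]| <= 1.
Proof.
move=> H; apply/card_le1_eqP => -[s1 t1] [s2 t2]; rewrite !inE /= => P1 P2.
by have [/val_inj-> /val_inj->] := H _ _ _ _ P1 P2.
Qed.

Lemma card_MUS_deleted : #|M' :\: M| <= 1.
Proof.
apply: leq_trans (@card_le1_inj (fun s t => mus f i.+1 j s t && ~~ mus f i j s t) _).
  by apply/subset_leq_card/subsetP => p; rewrite in_setD !(in_MUS x0) // ?(ltnW ij) // inE andbC.
move=> s1 t1 s2 t2 /andP[m1 n1] /andP[m2 n2]; exact: mus_deleted_unique m1 n1 m2 n2.
Qed.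

Lemma card_MUS_deleted_gt0 s l : i < s -> 0 < l -> s + l <= j.+1 ->
  same_factor f i s l -> ~~ repeats f i.+1 j s l -> 0 < #|M' :\: M|.
Proof.
move=> is0 l0 sl e u; have [q [r /andP[m n]]] := mus_deleted_exists is0 l0 sl e u.
apply/card_gt0P; exists (inord q, inord r).
case/and5P: (m) => iq qr rj _ _.
by rewrite in_setD !(in_MUS x0) // ?(ltnW ij) // /= !inordK ?m ?n //; lia.
Qed.

(** The 1 is for the interval starting at [i]. Each of the other two kinds has at most one member,
    and such a member exhibits a prefix occurring once in the shorter window, which forces a
    deletion; so the number of deletions bounds each kind. *)
Lemma card_MUS_added : #|M :\: M'| <= 1 + 2 * #|M' :\: M|.
Proof.
pose X (P : nat -> nat -> bool) := [set p : 'I_(size T).+1 * 'I_(size T).+1 | P p.1 p.2].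
pose P0 (s t : nat) := (s == i) && mus f i j s t.
have le1 (P : nat -> nat -> bool) : (forall s1 t1 s2 t2, P s1 t1 -> P s2 t2 -> (s1, t1) = (s2, t2)) ->
    (forall s t, P s t -> 0 < #|M' :\: M|) -> #|X P| <= #|M' :\: M|.
  move=> uP eP; case: (posnP #|X P|) => [-> //|/card_gt0P[p]].
  by rewrite inE => /eP D0; apply: leq_trans (card_le1_inj uP) D0.
have c0 : #|X P0| <= 1.
  apply: card_le1_inj => s1 t1 s2 t2 /andP[/eqP -> m1] /andP[/eqP -> m2].
  by rewrite (mus_same_start m1 m2).
have cR : #|X (right_added f i j)| <= #|M' :\: M|.
  apply: le1 => [s1 t1 s2 t2|s t /and5P[m is0 st e u]]; first exact: right_added_unique.
  by case/and5P: m => _ _ tj _ _; apply: card_MUS_deleted_gt0 e u; lia.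
have cL : #|X (left_added f i j)| <= #|M' :\: M|.
  apply: le1 => [s1 t1 s2 t2|s t /and5P[m is0 st e u]]; first exact: left_added_unique.
  by case/and5P: m => _ _ tj _ _; apply: card_MUS_deleted_gt0 e u; lia.
have sub : M :\: M' \subset X P0 :|: (X (right_added f i j) :|: X (left_added f i j)).
  apply/subsetP => p; rewrite in_setD !(in_MUS x0) // ?(ltnW ij) // !inE => /andP[n m].
  by have := mus_addedP m n; rewrite /P0 m andbT.
apply: leq_trans (subset_leq_card sub) _.
apply: leq_trans (leq_card_setU _ _) _; apply: leq_add => //.
by apply: leq_trans (leq_card_setU _ _) _; rewrite mul2n -addnn leq_add.
Qed.

End Cardinals.

Lemma card_symdiff (X : finType) (B C : {set X}) :
  #|symdiff B C| = #|B :\: C| + #|C :\: B|.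
Proof.
rewrite /symdiff cardsU; suff -> : (B :\: C) :&: (C :\: B) = set0 by rewrite cards0 subn0.
by apply/setP => x; rewrite !inE; case: (x \in B); case: (x \in C).
Qed.

(** Both sides count the union. *)
Lemma card_setD_balance (X : finType) (B C : {set X}) :
  #|B| + #|C :\: B| = #|C| + #|B :\: C|.
Proof. by rewrite -(cardsID C B) -(cardsID B C) setIC -!addnA [X in _ + X]addnC. Qed.

(** * A window whose extension adds three intervals *)

Section Gain.
Variables (Sigma : eqType) (a b c : Sigma) (f : nat -> Sigma) (o k : nat).
Hypotheses (ab : a != b) (bc : b != c) (ca : c != a) (ok : o + 2 <= k).
(* The window [o..k.+3] reads c a^m c b b with m >= 2. *)
Hypothesis fE : forall p, o <= p <= k.+3 ->
  f p = if (p == o) || (p == k.+1) then c else if p < k.+1 then a else b.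

Let fc p : o <= p <= k.+3 -> f p = c -> p = o \/ p = k.+1.
Proof.
move=> /fE ->; case: ifP => [/orP[]/eqP ->|_]; [by left|by right|].
by case: ifP => _ E; [move: ca|move: bc]; rewrite E eqxx.
Qed.

Let fa p : o <= p <= k.+3 -> f p = a -> o < p < k.+1.
Proof.
move=> op; rewrite (fE op); case: ifP => [_ E|]; first by move: ca; rewrite E eqxx.
by case: ifP => [|_ _ E]; [lia | move: ab; rewrite E eqxx].
Qed.

(** The three intervals read [ca], [ac] and [cb]. The first starts at [o]; the other two contain the
    [c] at [k.+1], which repeats only because of the [c] at [o]. *)
Lemma gain_added :
  [/\ mus f o k.+3 o o.+1,
      mus f o k.+3 k k.+1 && ~~ mus f o.+1 k.+3 k k.+1 &
      mus f o k.+3 k.+1 k.+2 && ~~ mus f o.+1 k.+3 k.+1 k.+2].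
Proof.
have fo : f o = c by rewrite fE ?eqxx //; lia.
have fk : f k.+1 = c by rewrite fE ?eqxx ?orbT //; lia.
have fA p : o < p < k.+1 -> f p = a.
  by move=> op; rewrite fE; [do 2?case: ifP => //; lia | lia].
have fB p : k.+1 < p <= k.+3 -> f p = b.
  by move=> op; rewrite fE; [do 2?case: ifP => //; lia | lia].
have rc : repeats f o k.+3 k.+1 1.
  by apply/repeats1P; exists o; split; [lia | lia | rewrite fo].
have nrc : ~~ repeats f o.+1 k.+3 k.+1 1.
  by apply/repeats1P => -[p [H1 H2]]; rewrite fk => /fc; lia.
rewrite !mus2E rc (negbTE nrc) !andbF !andbT; split.
- apply/and5P; split; [lia | lia | | |].
  + apply/repeats2P => -[p [H1 H2]]; rewrite fo (fA o.+1); last lia.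
    by move=> /fc H3 /fa; lia.
  + by apply/repeats1P; exists k.+1; split; [lia | lia | rewrite fo].
  + by apply/repeats1P; exists o.+2; split; [lia | lia | rewrite !fA //; lia].
- apply/and4P; split; [lia | lia | |].
  + apply/repeats2P => -[p [H1 H2]]; rewrite fk => _ /fc; lia.
  (* [o + 2 <= k] puts [o.+1] before [k], which gives a second [a]. *)
  + by apply/repeats1P; exists o.+1; split; [lia | lia | rewrite !fA //; lia].
- apply/and4P; split; [lia | lia | |].
  + apply/repeats2P => -[p [H1 H2]]; rewrite fk => E;
    have [|pE|] := @fc p _ E; [lia | | lia]; subst p.
    by rewrite (fA o.+1) ?(fB k.+2); [move=> E2; move: ab; rewrite E2 eqxx | lia | lia].
  (* This is what the doubled final [b] is for. *)
  + by apply/repeats1P; exists k.+3; split; [lia | lia | rewrite !fB //; lia].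
Qed.

End Gain.

(** * A window whose extension deletes an interval and adds none *)

Section Loss.
Variables (Sigma : eqType) (a b c : Sigma) (f : nat -> Sigma) (o k : nat).
Hypotheses (ab : a != b) (bc : b != c) (ca : c != a) (ok : o + 2 <= k).
(* The window [o..k.+3] reads a b a^m c a b with m >= 1. *)
Hypothesis fE : forall p, o <= p <= k.+3 ->
  f p = if (p == o.+1) || (p == k.+3) then b else if p == k.+1 then c else a.

Let fb p : o <= p <= k.+3 -> f p = b -> p = o.+1 \/ p = k.+3.
Proof.
move=> /fE ->; case: ifP => [/orP[]/eqP ->|_]; [by left|by right|].
by case: ifP => _ E; [move: bc|move: ab]; rewrite E eqxx.
Qed.

Let fc p : o <= p <= k.+3 -> f p = c -> p = k.+1.
Proof.
move=> op; rewrite (fE op); case: ifP => [_ E|_]; first by move: bc; rewrite E eqxx.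
by case: ifP => [/eqP -> //|_ E]; move: ca; rewrite E eqxx.
Qed.

Let fa p : o <= p <= k.+3 -> p != o.+1 -> p != k.+1 -> p != k.+3 -> f p = a.
Proof. by move=> op p1 p2 p3; rewrite fE //; do 2?case: ifP => //; lia. Qed.

Let fb1 : f o.+1 = b.
Proof. by rewrite fE ?eqxx //; lia. Qed.

Let fb2 : f k.+3 = b.
Proof. by rewrite fE ?eqxx ?orbT //; lia. Qed.

(** The shorter window has an [a] at [o.+2] and another at [k.+2]; at least one of them differs from
    [s]. *)
Let repeats_a s : o <= s <= k.+3 -> f s = a -> repeats f o.+1 k.+3 s 1.
Proof.
move=> os fs; apply/repeats1P; have [->|so] := eqVneq s o.+2.
  by exists k.+2; split; [lia | lia | rewrite !fa //; lia].
by exists o.+2; split; [lia | lia | rewrite fs fa //; lia].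
Qed.

(** The final [ab] occurs elsewhere only at [o], so it is unique in the shorter window alone. *)
Lemma loss_deleted : mus f o.+1 k.+3 k.+2 k.+3 && ~~ mus f o k.+3 k.+2 k.+3.
Proof.
rewrite !mus2E; apply/andP; split.
  apply/and5P; split; [lia | lia | | |].
  - by apply/repeats2P => -[p [H1 H2 _]]; rewrite fb2 => /fb; lia.
  - by apply: repeats_a; [lia | rewrite fa //; lia].
  - by apply/repeats1P; exists o.+1; split; [lia | lia | rewrite fb1].
rewrite !negb_and !negbK; apply/orP; right; apply/orP; right; apply/orP; left.
by apply/repeats2P; exists o; split; [lia | lia | rewrite !fa //; lia | rewrite fb1].
Qed.

(** For [s > o], a proper factor repeating only thanks to [o] would begin with [ab], since a lone
    [a] still repeats; the positions of [b] rule this out. No MUS starts at [o] either. *)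
Lemma loss_added s t : mus f o k.+3 s t -> mus f o.+1 k.+3 s t.
Proof.
move=> /and5P[os st tk u /implyP r]; have fo : f o = a by rewrite fa //; lia.
have [so|os'] := leqP s o; last first.
  apply/and5P; split=> //; first exact: contra (@repeats_window _ f _ _ _ _) u.
  apply/implyP => st'; have /andP[r1 r2] := r st'; apply/andP; split.
    apply/negPn/negP => nr; have [_ e] := repeats_at_start r1 nr.
    have [l2|l1] := leqP 2 (t - s).
      (* A prefix beginning with [ab] past [o] sits at [k.+2], so [t] would overrun the window. *)
      by have := e 1 l2; rewrite !addn1 fb1 => /esym/fb; lia.
    have lE : t - s = 1 by lia.
    case/negP: nr; rewrite lE; apply: repeats_a; first lia.
    by have := e 0; rewrite lE !addn0 fo => <-.
  apply/negPn/negP => nr; have [_ e] := repeats_at_start r2 nr.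
  have [l2|l1] := leqP 2 (t - s).
    (* A suffix beginning with [ab] sits at [k.+2], so the interval starts with the only [c] and its
       prefix cannot repeat. *)
    have := e 1 l2; rewrite !addn1 fb1 => /esym/fb sk.
    have sE : s = k.+1 by lia.
    have /repeats1P[p [H1 H2 H3]] : repeats f o k.+3 s 1 by apply: repeats_sub r1; lia.
    have fk : f k.+1 = c by rewrite fE; [do 2?case: ifP => //; lia | lia].
    by move: H3; rewrite sE fk => /fc; lia.
  have lE : t - s = 1 by lia.
  case/negP: nr; rewrite lE; apply: repeats_a; first lia.
  by have := e 0; rewrite lE !addn0 fo => <-.
have sE : s = o by lia.
subst s; exfalso; have [tgt|tlt] := leqP o.+2 t.
  (* The suffix would contain the [ba] at [o.+1], the only one in the window. *)
  have /andP[_ r2] : repeats f o k.+3 o (t - o) && repeats f o k.+3 o.+1 (t - o)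
    by apply: r; lia.
  have /repeats2P[p [H1 H2]] : repeats f o k.+3 o.+1 2 by apply: repeats_sub r2; lia.
  by rewrite fb1 => /fb; lia.
case/negP: u; have r2 : repeats f o k.+3 o 2.
  apply/repeats2P; exists k.+2.
  by split; [lia | lia | rewrite fo fa //; lia | rewrite fb1].
by apply: repeats_sub r2; lia.
Qed.

End Loss.

(** * The bounds and the strings attaining them *)

Lemma card_MUS_bounds (A : eqType) (T : seq A) (i j : nat) :
  0 < i -> i < j -> j <= size T ->
  #|MUS T i.+1 j :\: MUS T i j| <= 1 /\
  #|MUS T i j :\: MUS T i.+1 j| <= 1 + 2 * #|MUS T i.+1 j :\: MUS T i j|.
Proof.
case: T => [|x T] i0 ij jT; first by move: jT => /=; lia.
by split; [exact: (card_MUS_deleted x) | exact: (card_MUS_added x)].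
Qed.

(** With d <= 1 deletions there are at most 1 + 2d additions: the total is at most 1 + 3d, and the
    difference lies between -d and 1 + d. *)
Lemma MUS_diff_bounds (A : eqType) (T : seq A) (i j : nat) :
  0 < i -> i < j -> j <= size T ->
  #|symdiff (MUS T i j) (MUS T i.+1 j)| <= 4 /\
  (-1 <= #|MUS T i j|%:Z - #|MUS T i.+1 j|%:Z <= 2)%R.
Proof.
move=> i0 ij jT; have [d1 d2] := card_MUS_bounds i0 ij jT.
have e := card_setD_balance (MUS T i j) (MUS T i.+1 j).
by rewrite card_symdiff; lia.
Qed.

(** Three additions meet the bound 1 + 2d with d <= 1, so d = 1 and both estimates are
    equalities. *)
Lemma MUS_three_added (A : eqType) (T : seq A) (i j : nat) :
  0 < i -> i < j -> j <= size T -> 3 <= #|MUS T i j :\: MUS T i.+1 j| ->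
  #|symdiff (MUS T i j) (MUS T i.+1 j)| = 4 /\
  (#|MUS T i j|%:Z - #|MUS T i.+1 j|%:Z = 2)%R.
Proof.
move=> i0 ij jT; have [d1 d2] := card_MUS_bounds i0 ij jT.
have e := card_setD_balance (MUS T i j) (MUS T i.+1 j).
by rewrite card_symdiff; lia.
Qed.

Lemma MUS_none_added (A : eqType) (T : seq A) (i j : nat) :
  0 < i -> i < j -> j <= size T -> MUS T i j \subset MUS T i.+1 j ->
  0 < #|MUS T i.+1 j :\: MUS T i j| ->
  (#|MUS T i j|%:Z - #|MUS T i.+1 j|%:Z = -1)%R.
Proof.
move=> i0 ij jT; rewrite -setD_eq0 -cards_eq0 => /eqP d0 dgt.
have [d1 d2] := card_MUS_bounds i0 ij jT.
have e := card_setD_balance (MUS T i j) (MUS T i.+1 j).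
by lia.
Qed.

Lemma string_of_fun (A : eqType) (x : A) (g : nat -> A) n :
  exists T : seq A, size T = n /\ forall p, 0 < p <= n -> nth x T p.-1 = g p.
Proof.
exists (mkseq (fun q => g q.+1) n); split; first by rewrite size_mkseq.
by case=> // p pn; rewrite nth_mkseq.
Qed.

Lemma MUS_gain (A : eqType) (a b c : A) (n o k : nat) :
  a != b -> b != c -> c != a -> 0 < o -> o + 2 <= k -> k.+3 <= n ->
  exists T : seq A,
    [/\ size T = n, #|symdiff (MUS T o k.+3) (MUS T o.+1 k.+3)| = 4 &
        (#|MUS T o k.+3|%:Z - #|MUS T o.+1 k.+3|%:Z = 2)%R].
Proof.
move=> ab bc ca o0 ok kn.
have [T [szT TE]] := string_of_fun a (fun p =>
  if (p == o) || (p == k.+1) then c else if p < k.+1 then a else b) n.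
have kT : k.+3 <= size T by rewrite szT.
have ok3 : o < k.+3 by lia.
suff /(MUS_three_added o0 ok3 kT)[E1 E2] :
  3 <= #|MUS T o k.+3 :\: MUS T o.+1 k.+3| by exists T.
have [|a1 /andP[a2 a2'] /andP[a3 a3']] :=
    @gain_added A a b c (fun p => nth a T p.-1) o k ab bc ca ok.
  by move=> p op; apply: TE; lia.
have K1 : k.+1 < (size T).+1 by lia.
have K2 : k.+2 < (size T).+1 by lia.
have O1 : o.+1 < (size T).+1 by lia.
have O0 := ltnW O1; have K0 := ltnW K1; have ok3' := ltnW ok3.
apply/card_gt2P.
exists (inord o, inord o.+1), (inord k, inord k.+1), (inord k.+1, inord k.+2).
split; split; rewrite ?in_setD ?(in_MUS a) //= ?xpair_eqE -?val_eqE /= ?inordK //.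
- by rewrite a1 /mus ltnn.
- by rewrite a2 a2'.
- by rewrite a3 a3'.
all: by clear -ok; lia.
Qed.

Lemma MUS_loss (A : eqType) (a b c : A) (n o k : nat) :
  a != b -> b != c -> c != a -> 0 < o -> o + 2 <= k -> k.+3 <= n ->
  exists T : seq A,
    size T = n /\ (#|MUS T o k.+3|%:Z - #|MUS T o.+1 k.+3|%:Z = -1)%R.
Proof.
move=> ab bc ca o0 ok kn.
have [T [szT TE]] := string_of_fun a (fun p =>
  if (p == o.+1) || (p == k.+3) then b else if p == k.+1 then c else a) n.
have kT : k.+3 <= size T by rewrite szT.
have ok3 : o < k.+3 by lia.
have ok3' := ltnW ok3.
have fE p : o <= p <= k.+3 -> nth a T p.-1 =
    if (p == o.+1) || (p == k.+3) then b else if p == k.+1 then c else a.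
  by move=> op; apply: TE; lia.
exists T; split=> //; apply: MUS_none_added => //.
  apply/subsetP => p; rewrite !(in_MUS a) //.
  exact: (@loss_added _ a b c (fun p => nth a T p.-1)).
have /andP[d1 d2] := @loss_deleted _ a b c (fun p => nth a T p.-1) o k ab bc ca ok fE.
apply/card_gt0P; exists (inord k.+2, inord k.+3).
have K2 : k.+2 < (size T).+1 by lia.
by rewrite in_setD !(in_MUS a) //= !inordK // d1 d2.
Qed.

Theorem theorem2 :
  (forall (Sigma : finType), 2 <= #|Sigma| ->
   forall (T : seq Sigma) (i j : nat), 1 < i -> i <= j -> j <= size T ->
     #|symdiff (MUS T i.-1 j) (MUS T i j)| <= 4 /\
     (-1 <= (#|MUS T i.-1 j|%:Z - #|MUS T i j|%:Z) <= 2)%R)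
  /\
  (forall (Sigma : finType), 3 <= #|Sigma| ->
   forall (n i j : nat), 1 < i -> i <= j -> j <= n -> 5 <= j - i + 1 ->
     (exists T : seq Sigma, size T = n /\ #|symdiff (MUS T i.-1 j) (MUS T i j)| = 4) /\
     (exists T : seq Sigma, size T = n /\
        (#|MUS T i.-1 j|%:Z - #|MUS T i j|%:Z = 2)%R) /\
     (exists T : seq Sigma, size T = n /\
        (#|MUS T i.-1 j|%:Z - #|MUS T i j|%:Z = -1)%R)).
Proof.
split=> [Sigma _ T [//|i] j i1 ij jT|Sigma]; first exact: MUS_diff_bounds.
move=> /card_gt2P[a [b [c [_ [ab bc ca]]]]] n [//|o] j o0 ij jn l5.
(* With [k = j - 3], length at least 5 for the shorter window amounts to [o + 2 <= k], the room that
   both patterns require. *)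
have [k jE] : exists k, j = k.+3 by exists (j - 3); lia.
subst j; have ok : o + 2 <= k by lia.
have [T [sT T4 T2]] := MUS_gain ab bc ca o0 ok jn.
have [T' [sT' T1]] := MUS_loss ab bc ca o0 ok jn.
by split; [exists T | split; [exists T | exists T']].
Qed.
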